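(* Let $\mathfrak{g}$ be an integrable LCK Lie algebra with Lee vector $U$ and anti-Lee vector $V$. Then $\mathfrak{h}:=\langle U,V\rangle^\perp$ is a Kähler ideal in $\mathfrak{g}$; that is, $\mathfrak{h}$ is a $J$-invariant ideal of $\mathfrak{g}$ and $\mathfrak h$ with the restrictions of $g$ and $J$ is a Kähler Lie algebra.
   Context: Lie algebras are real and finite-dimensional; for $\alpha\in\mathfrak{g}^*$ the Chevalley-Eilenberg differential satisfies $d\alpha(X,Y)=-\alpha([X,Y])$, and for a $2$-form $\Omega$, $d\Omega(X,Y,Z)=-\Omega([X,Y],Z)-\Omega([Y,Z],X)-\Omega([Z,X],Y)$. An LCK structure on a Lie algebra $\mathfrak{g}$ of dimension $2n+2$ ($n\ge1$) consists of a positive definite inner product $g$, an endomorphism $J$ with $J^2=-\mathrm{Id}$ and $N_J(X,Y)=[JX,JY]-[X,Y]-J[JX,Y]-J[X,JY]=0$ for all $X,Y$, such that $\Omega(X,Y)=g(X,JY)$ is a $2$-form, and $1$-forms $\theta,\eta\in\mathfrak g^*$ with $d\Omega=\theta\wedge\Omega$, $d\theta=0$, and $\eta(X)=-\theta(JX)$. The Lee vector $U$ and anti-Lee vector $V$ are the metric duals of $\theta$ and $\eta$ (so $V=JU$). By rescaling the metric it is always assumed that $|\theta|=1$. The LCK Lie algebra is integrable if $\eta\wedge d\eta=0$. A Kähler Lie algebra is a Lie algebra with an inner product $g$ and an endomorphism $J$ with $J^2=-\mathrm{Id}$, $N_J=0$, $g(JX,JY)=g(X,Y)$, and $d\omega=0$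 for $\omega(X,Y)=g(X,JY)$. *)

(* Defs.v *)
From HB Require Import structures.
From mathcomp Require Import all_boot all_order all_algebra sesquilinear.
From mathcomp Require Import reals.

Set Implicit Arguments.
Unset Strict Implicit.
Unset Printing Implicit Defensive.

Import Order.TTheory GRing.Theory Num.Theory.
Local Open Scope ring_scope.

Section LieAlgebra.
Variables (R : realType) (L : vectType R).

Record is_lie_bracket (br : {bilinear L -> L -> L}) : Prop := {
  lie_alternating : forall X, br X X = 0;
  lie_jacobi : forall X Y Z,
    br X (br Y Z) + br Y (br Z X) + br Z (br X Y) = 0 }.

Definition is_ideal (br : {bilinear L -> L -> L}) (I : {vspace L}) : Prop :=
  forall X Y, Y \in I -> br X Y \in I.

Definition invariant_subspace (J : 'End(L)) (W : {vspace L}) : Prop :=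
  forall X, X \in W -> J X \in W.

Definition is_two_form (Om : L -> L -> R) : Prop :=
  [/\ forall Y, scalar (Om^~ Y), forall X, scalar (Om X)
    & forall X, Om X X = 0].

Definition d1 (br : {bilinear L -> L -> L}) (al : L -> R) (X Y : L) : R :=
  - al (br X Y).

Definition d2 (br : {bilinear L -> L -> L}) (Om : L -> L -> R)
    (X Y Z : L) : R :=
  - Om (br X Y) Z - Om (br Y Z) X - Om (br Z X) Y.

(* The normalisation without factorial coefficients, for which the
   differentials above are graded derivations of the wedge product. *)
Definition wedge12 (al : L -> R) (Om : L -> L -> R) (X Y Z : L) : R :=
  al X * Om Y Z + al Y * Om Z X + al Z * Om X Y.

Definition nijenhuis (br : {bilinear L -> L -> L}) (J : 'End(L))
    (X Y : L) : L :=
  br (J X) (J Y) - br X Y - J (br (J X) Y) - J (br X (J Y)).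

Definition is_complex_structure (br : {bilinear L -> L -> L}) (J : 'End(L))
    : Prop :=
  (forall X, J (J X) = - X) /\ (forall X Y, nijenhuis br J X Y = 0).

Definition fundamental_form (g : {dot L for idfun}) (J : 'End(L))
    (X Y : L) : R := g X (J Y).

Definition is_metric_dual (g : {dot L for idfun}) (al : L -> R) (A : L)
    : Prop :=
  forall X, g A X = al X.

Definition dot_norm (g : {dot L for idfun}) (X : L) : R := Num.sqrt (g X X).

Record is_lck (br : {bilinear L -> L -> L}) (g : {dot L for idfun})
    (J : 'End(L)) (theta eta : {scalar L}) : Prop := {
  lck_lie : is_lie_bracket br;
  lck_complex : is_complex_structure br J;
  lck_form : is_two_form (fundamental_form g J);
  lck_dform : forall X Y Z,
    d2 br (fundamental_form g J) X Y Z
    = wedge12 theta (fundamental_form g J) X Y Z;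
  lck_closed : forall X Y, d1 br theta X Y = 0;
  lck_eta : forall X, eta X = - theta (J X) }.

Definition is_integrable (br : {bilinear L -> L -> L}) (eta : {scalar L})
    : Prop :=
  forall X Y Z, wedge12 eta (d1 br eta) X Y Z = 0.

Record is_kahler (br : {bilinear L -> L -> L}) (g : {dot L for idfun})
    (J : 'End(L)) : Prop := {
  kahler_lie : is_lie_bracket br;
  kahler_complex : is_complex_structure br J;
  kahler_hermitian : forall X Y, g (J X) (J Y) = g X Y;
  kahler_closed : forall X Y Z, d2 br (fundamental_form g J) X Y Z = 0 }.

End LieAlgebra.

Section Restriction.
Variables (R : realType) (L : vectType R) (W : {vspace L}).

(* [vsproj W] is the identity on [W], so [sub_bracket] and [sub_endo] are the
   restrictions to [W] as soon as [W] is stable under the bracket and under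
   the endomorphism; otherwise their values are junk. *)
Definition sub_bracket (br : {bilinear L -> L -> L}) (x y : subvs_of W)
    : subvs_of W := vsproj W (br (vsval x) (vsval y)).

Definition sub_endo (J : 'End(L)) : 'End(subvs_of W) :=
  linfun (vsproj W \o J \o vsval).

Definition sub_dot (g : {dot L for idfun}) (x y : subvs_of W) : R :=
  g (vsval x) (vsval y).


Fact sub_bracket_bilinear (br : {bilinear L -> L -> L}) :
  bilinear_for (GRing.Scale.Law.clone _ _ *:%R _)
    (GRing.Scale.Law.clone _ _ *:%R _) (sub_bracket br).
Proof.
by split=> [u'|u] a x y; rewrite /sub_bracket linearP /= ?linearPl ?linearPr
  linearP.
Qed.

HB.instance Definition _ (br : {bilinear L -> L -> L}) :=
  bilinear_isBilinear.Build R (subvs_of W) (subvs_of W) (subvs_of W) _ _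
    (sub_bracket br) (sub_bracket_bilinear br).

Fact sub_dot_bilinear (g : {dot L for idfun}) :
  bilinear_for (GRing.Scale.Law.clone _ _ *%R _)
    (GRing.Scale.Law.clone _ _ (idfun \; *%R) _) (sub_dot g).
Proof.
by split=> [u'|u] a x y; rewrite /sub_dot linearP /= ?linearPl ?linearPr.
Qed.

HB.instance Definition _ (g : {dot L for idfun}) :=
  bilinear_isBilinear.Build R (subvs_of W) (subvs_of W) R _ _
    (sub_dot g) (sub_dot_bilinear g).

Fact sub_dot_sym (g : {dot L for idfun}) (x y : subvs_of W) :
  sub_dot g x y = (-1) ^+ false * idfun (sub_dot g y x).
Proof. exact: hermitian_subproof. Qed.

HB.instance Definition _ (g : {dot L for idfun}) :=
  isHermitianSesquilinear.Build R (subvs_of W) false idfun (sub_dot g)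
    (sub_dot_sym g).

Fact sub_dot_gt0 (g : {dot L for idfun}) (x : subvs_of W) :
  x != 0 -> 0 < sub_dot g x x.
Proof. by move=> x0; apply: neq0_dnorm_gt0; rewrite -(inj_eq val_inj) in x0. Qed.

HB.instance Definition _ (g : {dot L for idfun}) :=
  isDotProduct.Build R (subvs_of W) (sub_dot g) (@sub_dot_gt0 g).

End Restriction.

Arguments sub_bracket {R L} W br x y.
Arguments sub_dot {R L} W g x y.

(* Main.v *)
Require Import Defs.
From mathcomp Require Import all_boot all_order all_algebra sesquilinear.
From mathcomp Require Import reals lra.

Set Implicit Arguments.
Unset Strict Implicit.
Unset Printing Implicit Defensive.

Import Order.TTheory GRing.Theory Num.Theory.
Local Open Scope ring_scope.

(** The metric duality of [theta] and [U], and of [eta] and [V = J U], turns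
    [h = <U, V>^perp] into the intersection of [ker theta] and [ker eta].  It is
    [J]-stable because [eta = - theta \o J], and the fundamental form is
    closed on it because [theta] vanishes there ([kahler_restriction]).

    The substance is that [h] is an ideal.  As [theta] is closed, every bracket
    lies in [ker theta], so only [eta] has to be controlled.  Integrability
    says, by the Frobenius argument, that [ker eta] is a subalgebra
    ([integrable_ker_subalgebra]); since [L = ker eta + <V>], it remains to see
    that [eta [V, Y] = 0] for [Y] in [h].  Evaluating [eta] on the Nijenhuis
    identity for the pair [(U, Y)] gives this: as [eta \o J = theta] kills
    brackets, what is left is [eta [V, J Y] = eta [U, Y]], and the right-hand
    side vanishes because [U] and [Y] are in the subalgebra [ker eta]
    ([antilee_bracket_ker]). *)

Section SubspaceRestriction.
Variables (R : realType) (L : vectType R) (W : {vspace L}).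

(** [vsproj W] splits [vsval] only on [W]: stability of [W] is what makes the
    restricted operations agree with the ambient ones. *)
Lemma vsval_sub_bracket (br : {bilinear L -> L -> L}) (x y : subvs_of W) :
  is_ideal br W -> vsval (sub_bracket W br x y) = br (vsval x) (vsval y).
Proof. by move=> idW; rewrite vsprojK // idW // subvsP. Qed.

Lemma vsval_sub_endo (J : 'End(L)) (x : subvs_of W) :
  invariant_subspace J W -> vsval (sub_endo W J x) = J (vsval x).
Proof. by move=> JW; rewrite lfunE /= vsprojK // JW // subvsP. Qed.

End SubspaceRestriction.

Section LieAlgebra.
Variables (R : realType) (L : vectType R).
Implicit Types (br : {bilinear L -> L -> L}) (g : {dot L for idfun}).
Implicit Types (J : 'End(L)) (theta eta : {scalar L}) (W : {vspace L}).

Lemma two_form_anti (Om : L -> L -> R) X Y :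
  is_two_form Om -> Om X Y = - Om Y X.
Proof.
case=> linl linr alt.
have addl u v w : Om (u + v) w = Om u w + Om v w.
  by have := linl w 1 u v; rewrite scale1r /= mul1r.
have addr w u v : Om w (u + v) = Om w u + Om w v.
  by have := linr w 1 u v; rewrite scale1r /= mul1r.
by apply/eqP; rewrite -addr_eq0 -(alt (X + Y)) addl !addr !alt add0r addr0.
Qed.

Lemma dot_sym g X Y : g X Y = g Y X.
Proof. by rewrite hermC /= expr0 mul1r. Qed.

Lemma dot_definite g X : g X X = 0 -> X = 0.
Proof.
move=> gXX; apply/eqP; apply: contraT => X0.
by have := neq0_dnorm_gt0 (s := g) _ X0; rewrite gXX ltxx.
Qed.

Lemma dot_norm_eq1 g X : dot_norm g X = 1 -> g X X = 1.
Proof.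
rewrite /dot_norm; have [le0|/ltW ge0] := lerP (g X X) 0.
  by rewrite ler0_sqrtr // => /eqP; rewrite eq_sym oner_eq0.
by move=> sqrt1; rewrite -(sqr_sqrtr ge0) sqrt1 expr1n.
Qed.

Lemma two_form_skew g J X Y :
  is_two_form (fundamental_form g J) -> g X (J Y) = - g (J X) Y.
Proof. by move/(two_form_anti X Y); rewrite /fundamental_form (dot_sym g Y). Qed.

Lemma two_form_hermitian g J X Y :
    (forall X, J (J X) = - X) -> is_two_form (fundamental_form g J) ->
  g (J X) (J Y) = g X Y.
Proof.
by move=> JJ Om2; rewrite two_form_skew // JJ linearNl opprK.
Qed.

Lemma orthov_metric_dualE g (al be : {scalar L}) A B X :
    is_metric_dual g al A -> is_metric_dual g be B ->
  (X \in orthov g (<[A]> + <[B]>)%VS) = (al X == 0) && (be X == 0).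
Proof.
rewrite mem_orthov_sym subv_add -!mem_orthov_sym !mem_orthov1.
by move=> dualA dualB; rewrite -dualA -dualB (dot_sym g A) (dot_sym g B).
Qed.

(** Frobenius: contracting [eta /\ d eta = 0] with a vector [V] on which [eta]
    is [1] leaves [d eta X Y] alone when [X] and [Y] are in [ker eta]. *)
Lemma integrable_ker_subalgebra br eta V X Y :
    is_integrable br eta -> eta V = 1 -> eta X = 0 -> eta Y = 0 ->
  eta (br X Y) = 0.
Proof.
move=> /(_ X Y V) + V1 X0 Y0; rewrite /wedge12 /d1 V1 X0 Y0; lra.
Qed.

(** With [eta \o J = theta] and [theta] zero on brackets, [eta] kills both terms
    of [nijenhuis br J U (J Y)] in which [J] is applied outside a bracket.  The
    other two are [[J U, J (J Y)] = - [J U, Y]] and [[U, J Y]], and the latter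
    is a bracket inside [ker eta]: [eta (J Y) = theta Y = 0]. *)
Lemma antilee_bracket_ker br J theta eta U Y :
    is_complex_structure br J -> (forall X, eta X = - theta (J X)) ->
    (forall X Y, d1 br theta X Y = 0) ->
    (forall X Y, eta X = 0 -> eta Y = 0 -> eta (br X Y) = 0) ->
    eta U = 0 -> theta Y = 0 ->
  eta (br (J U) Y) = 0.
Proof.
move=> [JJ NJ] etaE closed sub U0 thY.
have th0 A B : theta (br A B) = 0.
  by apply/eqP; rewrite -oppr_eq0; apply/eqP/closed.
have etaJ A : eta (J A) = theta A by rewrite etaE JJ linearN opprK.
have := congr1 eta (NJ U (J Y)).
rewrite /nijenhuis !linearB /= !etaJ !th0 JJ linearNr linearN /= linear0.
rewrite (sub U (J Y)) ?etaJ //; lra.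
Qed.

(** The Lie and complex structures and the compatibility of [g] with [J] pass to
    every stable subspace; closedness of the fundamental form is what
    [d Omega = theta /\ Omega] becomes where [theta = 0]. *)
Lemma kahler_restriction br g J theta eta W :
    is_lck br g J theta eta -> is_ideal br W -> invariant_subspace J W ->
    (forall X, X \in W -> theta X = 0) ->
  is_kahler (sub_bracket W br) (sub_dot W g) (sub_endo W J).
Proof.
move=> [[alt jac] [JJ NJ] Om2 dOm _ _] idW JW th0.
split; first split.
- by move=> x; apply: subvs_inj; rewrite /= vsval_sub_bracket // alt.
- move=> x y z; apply: subvs_inj.
  by rewrite !linearD /= !vsval_sub_bracket // jac.
- split=> [x|x y]; apply: subvs_inj.
    by rewrite !vsval_sub_endo // JJ.
  rewrite /nijenhuis !linearB /= !(vsval_sub_endo, vsval_sub_bracket) //.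
  exact: NJ.
- move=> x y; rewrite /= /sub_dot !vsval_sub_endo //.
  exact: two_form_hermitian.
- move=> x y z; have := dOm (vsval x) (vsval y) (vsval z).
  rewrite /wedge12 !th0 ?subvsP // !mul0r !addr0 => <-.
  rewrite /d2 /fundamental_form /= /sub_dot.
  by rewrite !vsval_sub_endo // !vsval_sub_bracket.
Qed.

End LieAlgebra.

Theorem proposition4p1 (R : realType) (n : nat) (n_ge1 : (1 <= n)%N)
    (L : vectType R) (dimL : \dim {:L} = (2 * n + 2)%N)
    (br : {bilinear L -> L -> L}) (g : {dot L for idfun}) (J : 'End(L))
    (theta eta : {scalar L}) (U V : L)
    (lckL : is_lck br g J theta eta)
    (dualU : is_metric_dual g theta U) (dualV : is_metric_dual g eta V)
    (* the norm of a 1-form is that of its metric dual, so |theta| = 1 *)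
    (normU : dot_norm g U = 1)
    (intL : is_integrable br eta) :
  let h : {vspace L} := orthov g (<[U]> + <[V]>)%VS in
  [/\ is_ideal br h, invariant_subspace J h
    & is_kahler (sub_bracket h br) (sub_dot h g) (sub_endo h J)].
Proof.
move=> h.
have [_ cplx Om2 _ closed etaE] := lckL; have JJ := cplx.1.
have hE X : (X \in h) = (theta X == 0) && (eta X == 0).
  exact: orthov_metric_dualE.
have etaJ A : eta (J A) = theta A by rewrite etaE JJ linearN opprK.
have V_JU : V = J U.
  apply/eqP; rewrite -subr_eq0; apply/eqP; apply: (dot_definite (g := g)).
  by rewrite linearBl /= dualV etaE -dualU two_form_skew // opprK subrr.
have etaV : eta V = 1 by rewrite V_JU etaJ -dualU dot_norm_eq1.
have etaU : eta U = 0.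
  have thV : g U (J U) = 0 by case: Om2 => _ _; apply.
  by rewrite etaE -dualU thV oppr0.
have ker_sub := integrable_ker_subalgebra intL etaV.
have Jh : invariant_subspace J h.
  move=> X; rewrite !hE etaJ => /andP[-> /eqP].
  by rewrite etaE => /eqP; rewrite oppr_eq0 => ->.
have idh : is_ideal br h.
  move=> X Y; rewrite !hE => /andP[/eqP thY /eqP etaY]; apply/andP; split.
    by rewrite -oppr_eq0 -[- _]/(d1 br theta X Y) closed.
  have VY0 : eta (br V Y) = 0.
    by rewrite V_JU (antilee_bracket_ker cplx etaE closed ker_sub).
  (* Split X along L = ker eta + <V>; this uses eta V = 1. *)
  rewrite -[X](subrK (eta X *: V)) linearDl linearZl_LR linearD.
  rewrite [eta (_ *: _)]linearZ /= VY0 mulr0 addr0.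
  by rewrite ker_sub // linearB linearZ /= etaV mulr1 subrr.
split=> //; apply: kahler_restriction lckL idh Jh _ => X.
by rewrite hE => /andP[/eqP].
Qed.
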